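(* Let $X$ be a nonempty set and let $F\in\mathcal{F}_{\mathsf p}(X)$ be the pullback of a map $f:X\to X$ such that $\mathrm{Dom}(F)=X$. Let $n\ge 1$ be an integer, let $g:X\to X$ be a map, and let $G$ be the pullback of $g$. Then $G$ is an iterative root of $F$ of order $n$ in $\mathcal{F}_{\mathsf p}(X)$ if and only if $g$ is an iterative root of $f$ of order $n$ in the set of all maps from $X$ to $X$.
   Context: A multifunction on a nonempty set $X$ is a function $F:X\to 2^X$ (empty values allowed). $\mathrm{Dom}(F)=\{x\in X:F(x)\neq\emptyset\}$. Iterates of a multifunction: $G^0(x)=\{x\}$ and $G^n(x)=\bigcup_{y\in G^{n-1}(x)}G(y)$. A multifunction $G$ is an iterative root of order $n$ of a multifunction $F$ if $G^n(x)=F(x)$ for all $x\in X$; a map $g:X\to X$ is an iterative root of order $n$ of a map $f:X\to X$ if $g^n=f$, where $g^n$ is the $n$-fold composition of $g$ with itself. $F$ is the pullback of a map $f:X\to X$ if $F(x)=f^{-1}(\{x\})$ for all $x\in X$; $\mathcal{F}_{\mathsf p}(X)$ is the set of all multifunctions on $X$ that are the pullback of some map $X\to X$. *)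

(* Defs.v *)
From mathcomp Require Import all_boot.
From mathcomp Require Import boolp classical_sets.

Set Implicit Arguments.
Unset Strict Implicit.
Unset Printing Implicit Defensive.

Local Open Scope classical_set_scope.

(* Empty values are allowed. *)
Definition multifunction (X : Type) : Type := X -> set X.

Definition Dom (X : Type) (F : multifunction X) : set X := [set x | F x !=set0].

Fixpoint mf_iter (X : Type) (G : multifunction X) (n : nat) : multifunction X :=
  fun x => if n is m.+1 then \bigcup_(y in mf_iter G m x) G y else [set x].

Definition is_pullback (X : Type) (F : multifunction X) (f : X -> X) : Prop :=
  forall x, F x = f @^-1` [set x].

Definition pullbacks (X : Type) : set (multifunction X) :=
  [set F | exists f : X -> X, is_pullback F f].

(* A root "in C" is required to be a member of the class C. *)
Definition mf_iterative_root_in (X : Type) (C : set (multifunction X)) (n : nat)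
    (F G : multifunction X) : Prop :=
  C G /\ forall x, mf_iter G n x = F x.

Definition map_iterative_root_in (X : Type) (C : set (X -> X)) (n : nat)
    (f g : X -> X) : Prop :=
  C g /\ iter n g = f.

(* Main.v *)
Require Import Defs.
From mathcomp Require Import all_boot.
From mathcomp Require Import boolp classical_sets.

Local Open Scope classical_set_scope.

(** Taking pullbacks commutes with iteration ([is_pullback_iter]), and a map is determined by its
    pullback ([is_pullback_inj]). Hence $G^n=F$ exactly when $g^n=f$. *)

Lemma is_pullback_iter (X : Type) (g : X -> X) (G : multifunction X) (n : nat) :
  is_pullback G g -> is_pullback (mf_iter G n) (iter n g).
Proof.
move=> Gg; elim: n => [|n IHn] x; first by apply/seteqP; split=> z.
(* [mf_iter] applies [G] last, so going back from [z] the map [g] acts first: [iterSr] puts the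
   extra [g] innermost, and the intermediate point is [g z]. *)
apply/seteqP; split=> z; rewrite /preimage /= -iterS iterSr.
- by case=> y; rewrite IHn Gg => /= <- ->.
- by move=> gz; exists (g z); rewrite ?IHn ?Gg.
Qed.

(** Each [x] lies in [F (f x)], which is also the fibre of [g] over [f x]. *)
Lemma is_pullback_inj (X : Type) (F : multifunction X) (f g : X -> X) :
  is_pullback F f -> is_pullback F g -> f = g.
Proof.
move=> Ff Fg; apply/funext => x; apply/esym.
have : F (f x) x by rewrite Ff.
by rewrite Fg.
Qed.

Theorem theorem15 (X : Type) (X_nonempty : [set: X] !=set0)
    (F : multifunction X) (f : X -> X)
    (F_pullback : is_pullback F f) (F_dom : Dom F = [set: X])
    (n : nat) (n_ge1 : (1 <= n)%N)
    (g : X -> X) (G : multifunction X) (G_pullback : is_pullback G g) :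
  mf_iterative_root_in (@pullbacks X) n F G <->
  map_iterative_root_in [set: X -> X] n f g.
Proof.
have Gn : is_pullback (mf_iter G n) (iter n g) by exact: is_pullback_iter.
split=> [[_ GnF]|[_ gnf]]; split=> //.
(* Here [F] is the pullback of both [iter n g] and [f]. *)
- by apply: (@is_pullback_inj _ F) => // x; rewrite -GnF.
- by exists g.
- by move=> x; rewrite Gn gnf F_pullback.
Qed.
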